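(* There exists a non-commutative finite hypergroup $\mathcal{K}=\{c_0,c_1,c_2,c_3,c_4\}$ of order five whose involution on $K$ is given by $c_0^*=c_0$, $c_1^*=c_1$, $c_2^*=c_2$, $c_3^*=c_4$, $c_4^*=c_3$.
   Context: For a finite set $K=\{c_0,c_1,\dots,c_n\}$ (distinct elements), let $M^b(K)=\{\sum_{j=0}^n a_j\delta_{c_j}: a_j\in\mathbb{C}\}$ be the complex measures on $K$ and $M^1(K)=\{\sum_j a_j\delta_{c_j}: a_j\ge 0,\ \sum_j a_j=1\}$ the probability measures, where $\delta_c$ is the Dirac measure at $c$. The support of $\mu=\sum_j a_j\delta_{c_j}$ is $\mathrm{supp}(\mu)=\{c_j: a_j\neq 0\}$. A finite hypergroup $\mathcal{K}=(K,M^b(K),\circ,* )$ (also written $\mathcal{K}=\{c_0,\dots,c_n\}$) is a finite set $K=\{c_0,\dots,c_n\}$ together with a product $\circ$ (convolution) and an involution $*$ on $M^b(K)$ such that: (a) $(M^b(K),\circ,* )$ is an associative $*$-algebra with unit $\delta_{c_0}$; (b) $\delta_{c_i}\circ\delta_{c_j}\in M^1(K)$ for all $c_i,c_j\in K$; (c) there is an involutive bijection $c_i\mapsto c_i^*$ of $K$ with $\delta_{c_i^*}=\delta_{c_i}^*$, and for all $c_i,c_j\in K$ one has $c_j=c_i^*$ if and only if $c_0\in\mathrm{supp}(\delta_{c_i}\circ\delta_{c_j})$. The order of $\mathcal{K}$ is the number of elements of $K$. $\mathcal{K}$ is commutative if $\circ$ is commutative on $M^b(K)$. *)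

(* Defs.v *)
From HB Require Import structures.
From mathcomp Require Import all_boot all_order all_algebra.
From mathcomp Require Import complex reals.

Set Implicit Arguments.
Unset Strict Implicit.
Unset Printing Implicit Defensive.

Import Order.TTheory GRing.Theory Num.Theory.
Local Open Scope ring_scope.
Local Open Scope complex_scope.

(* M^b(K): the measure \sum_(x : K) a_x delta_x is encoded by the family of its
   coefficients x |-> a_x. Only the vector space structure of {ffun K -> R[i]}
   is relevant; its pointwise product is not the convolution. *)
Notation cmeasure R K := {ffun K -> R[i]}.

Definition dirac (R : realType) (K : finType) (c : K) : cmeasure R K :=
  [ffun x => (x == c)%:R].

Arguments dirac R {K} c.

Lemma cmeasure_sum_dirac (R : realType) (K : finType) (mu : cmeasure R K) :
  mu = \sum_(c : K) mu c *: dirac R c.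
Proof.
apply/ffunP => x; rewrite sum_ffunE (bigD1 x) //= big1 => [|c cx].
  by rewrite !ffunE eqxx addr0 [_ *: _]mulr1.
by rewrite !ffunE eq_sym (negPf cx) [_ *: _]mulr0.
Qed.

Definition supp (R : realType) (K : finType) (mu : cmeasure R K) : {set K} :=
  [set x | mu x != 0].

(* In the order of R[i], 0 <= z means that z is real and nonnegative. *)
Definition prob_measure (R : realType) (K : finType) (mu : cmeasure R K) : Prop :=
  (forall x, 0 <= mu x) /\ \sum_(x : K) mu x = 1.

Record hypergroup (R : realType) (K : finType) := Hypergroup {
  hunit : K;
  hconv : cmeasure R K -> cmeasure R K -> cmeasure R K;
  hstar : cmeasure R K -> cmeasure R K;
  hinv : K -> K;
  hconv_linearl : forall (a : R[i]) (mu nu rho : cmeasure R K),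
    hconv (a *: mu + nu) rho = a *: hconv mu rho + hconv nu rho;
  hconv_linearr : forall (a : R[i]) (mu nu rho : cmeasure R K),
    hconv rho (a *: mu + nu) = a *: hconv rho mu + hconv rho nu;
  hconvA : associative hconv;
  hconv1l : left_id (dirac R hunit) hconv;
  hconv1r : right_id (dirac R hunit) hconv;
  hstar_antilinear : forall (a : R[i]) (mu nu : cmeasure R K),
    hstar (a *: mu + nu) = a^* *: hstar mu + hstar nu;
  hstarK : involutive hstar;
  hstarM : forall mu nu : cmeasure R K,
    hstar (hconv mu nu) = hconv (hstar nu) (hstar mu);
  hconv_prob : forall x y : K, prob_measure (hconv (dirac R x) (dirac R y));
  hinvK : involutive hinv;
  hstar_dirac : forall x : K, dirac R (hinv x) = hstar (dirac R x);
  hinvP : forall x y : K,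
    y = hinv x <-> hunit \in supp (hconv (dirac R x) (dirac R y))
}.

Definition horder (R : realType) (K : finType) (H : hypergroup R K) : nat := #|K|.

Definition commutative_hypergroup (R : realType) (K : finType)
  (H : hypergroup R K) : Prop := commutative (hconv H).

(* Main.v *)
(* The algebra has to be C + M_2(C), with c_x = (1, t 1 + a_x . sigma) for
   x <> 0, where sigma is the triple of Pauli matrices, a_1, a_2 in R^3 and
   a_3, a_4 = u +- i v. Giving each c_x, x <> 0, the Haar weight w = 6 and
   requiring the coefficient of c_0 to be a trace in which the c_x are
   orthogonal with <c_x, c_x> = 1 / w_x forces t = - 1 / 24, and the a_x up to
   isometry: with p = (4 w + 1) / (16 w^2), one gets |a_1|^2 = |a_2|^2 = 3 p,
   a_1 . a_2 = - p, 2 u = - (a_1 + a_2), |v|^2 = 2 p and v orthogonal to a_1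
   and a_2. The structure constants are then rational since 4 w + 1 = 25 is a
   square, and nonnegative since w is large enough. *)
Require Import Defs.
From HB Require Import structures.
From mathcomp Require Import all_boot all_order all_algebra.
From mathcomp Require Import complex reals.

Set Implicit Arguments.
Unset Strict Implicit.
Unset Printing Implicit Defensive.

Import Order.TTheory GRing.Theory Num.Theory.

(** * Hypergroups from structure constants on a finite set *)

Section StructureConstants.

Local Open Scope ring_scope.

Variables (R : realType) (K : finType) (e : K) (i : K -> K).
(** [m x y z] stands for the coefficient of c_z in c_x c_y. Thus [m_assoc] compares the coefficients
    of c_t in (c_x c_y) c_z and c_x (c_y c_z), and [m_inv] makes c_x -> c_(i x) reverse products. *)
Variable m : K -> K -> K -> R[i].

Definition conv (mu nu : cmeasure R K) : cmeasure R K :=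
  [ffun z => \sum_x \sum_y mu x * nu y * m x y z].

(** The antilinear extension of c_x -> c_(i x): its coefficient at [x] comes from the preimage of
    [x] under [i], which is [i x] by [iK]. *)
Definition star (mu : cmeasure R K) : cmeasure R K := [ffun x => (mu (i x))^*].

Hypothesis m_ge0 : forall x y z, 0 <= m x y z.
Hypothesis m_sum1 : forall x y, \sum_z m x y z = 1.
Hypothesis m_assoc : forall x y z t,
  \sum_s m x y s * m s z t = \sum_s m y z s * m x s t.
Hypothesis m1l : forall y z, m e y z = (y == z)%:R.
Hypothesis m1r : forall x z, m x e z = (x == z)%:R.
Hypothesis iK : involutive i.
Hypothesis m_inv : forall x y z, m (i x) (i y) (i z) = m y x z.
Hypothesis m_unit : forall x y, y = i x <-> m x y e != 0.

Lemma sum_indicator (V : pzRingType) (F : K -> V) (c : K) :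
  \sum_x (x == c)%:R * F x = F c.
Proof.
rewrite (bigD1 c) //= eqxx mul1r big1 ?addr0 // => x /negPf ->.
by rewrite mul0r.
Qed.

Lemma conv_dirac x y z : conv (dirac R x) (dirac R y) z = m x y z.
Proof.
rewrite ffunE -(sum_indicator (fun s => m s y z)); apply: eq_bigr => s _.
rewrite -(sum_indicator (fun t => m s t z)) mulr_sumr; apply: eq_bigr => t _.
by rewrite !ffunE mulrA.
Qed.

Lemma conv_linearl a mu nu rho :
  conv (a *: mu + nu) rho = a *: conv mu rho + conv nu rho.
Proof.
apply/ffunP => z; rewrite !ffunE [X in _ = X + _]mulr_sumr -big_split.
apply: eq_bigr => x _.
rewrite /= mulr_sumr -big_split; apply: eq_bigr => y _ /=.
by rewrite !ffunE !mulrDl !mulrA.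
Qed.

Lemma conv_linearr a mu nu rho :
  conv rho (a *: mu + nu) = a *: conv rho mu + conv rho nu.
Proof.
apply/ffunP => z; rewrite !ffunE [X in _ = X + _]mulr_sumr -big_split.
apply: eq_bigr => x _.
rewrite /= mulr_sumr -big_split; apply: eq_bigr => y _ /=.
by rewrite !ffunE mulrDr mulrDl [rho x * _]mulrCA !mulrA.
Qed.

Lemma conv_assoc : associative conv.
Proof.
move=> mu nu rho; apply/ffunP => t; rewrite !ffunE.
(* Both sides are brought to a triple sum with the values of the measures factored out, so that
   [m_assoc] applies to the inner sum over [s]. *)
transitivity (\sum_x \sum_y \sum_z
  mu x * nu y * rho z * \sum_s m y z s * m x s t).
  apply: eq_bigr => x _.
  under eq_bigr do rewrite ffunE mulr_sumr mulr_suml.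
  rewrite exchange_big; apply: eq_bigr => y _ /=.
  under eq_bigr do rewrite mulr_sumr mulr_suml.
  rewrite exchange_big; apply: eq_bigr => z _ /=.
  by rewrite mulr_sumr; apply: eq_bigr => s _; rewrite !mulrA.
under eq_bigr do under eq_bigr do under eq_bigr do rewrite -m_assoc.
under [RHS]eq_bigr do under eq_bigr do rewrite ffunE -mulrA mulr_suml.
under [RHS]eq_bigr do rewrite exchange_big.
rewrite [RHS]exchange_big; apply: eq_bigr => x _ /=.
under [RHS]eq_bigr do under eq_bigr do rewrite mulr_suml.
under [RHS]eq_bigr do rewrite exchange_big.
rewrite [RHS]exchange_big; apply: eq_bigr => y _ /=.
rewrite [RHS]exchange_big; apply: eq_bigr => z _ /=.
rewrite mulr_sumr; apply: eq_bigr => s _; rewrite -!mulrA.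
by congr (_ * (_ * _)); rewrite mulrCA.
Qed.

Lemma conv1l : left_id (dirac R e) conv.
Proof.
move=> mu; apply/ffunP => z; rewrite ffunE.
transitivity (\sum_y mu y * m e y z); last first.
  by rewrite -[RHS]sum_indicator; apply: eq_bigr => y _; rewrite m1l mulrC.
rewrite -(sum_indicator (fun x => \sum_y mu y * m x y z)); apply: eq_bigr => x _.
by rewrite mulr_sumr; apply: eq_bigr => y _; rewrite ffunE mulrA.
Qed.

Lemma conv1r : right_id (dirac R e) conv.
Proof.
move=> mu; apply/ffunP => z; rewrite ffunE.
transitivity (\sum_x mu x * m x e z); last first.
  by rewrite -[RHS]sum_indicator; apply: eq_bigr => x _; rewrite m1r mulrC.
apply: eq_bigr => x _; rewrite -(sum_indicator (fun y => mu x * m x y z)).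
by apply: eq_bigr => y _; rewrite ffunE mulrA [_%:R * _]mulrC.
Qed.

Lemma star_antilinear a mu nu : star (a *: mu + nu) = a^* *: star mu + star nu.
Proof. by apply/ffunP => x; rewrite !ffunE rmorphD rmorphM. Qed.

Lemma starK : involutive star.
Proof. by move=> mu; apply/ffunP => x; rewrite !ffunE iK conjCK. Qed.

(** Reindexing both sums by [i] brings in [m_inv]; conjugation fixes the structure constants because
    they are nonnegative, hence real. *)
Lemma star_conv mu nu : star (conv mu nu) = conv (star nu) (star mu).
Proof.
apply/ffunP => z; rewrite !ffunE rmorph_sum (reindex_inj (inv_inj iK)) /=.
under eq_bigr do rewrite rmorph_sum (reindex_inj (inv_inj iK)) /=.
rewrite [LHS]exchange_big; apply: eq_bigr => y _; apply: eq_bigr => x _ /=.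
rewrite !ffunE !rmorphM m_inv /= (conj_Creal (ger0_real (m_ge0 _ _ _))).
by rewrite [_^* * _]mulrC.
Qed.

Lemma star_dirac x : dirac R (i x) = star (dirac R x).
Proof.
by apply/ffunP => y; rewrite !ffunE rmorph_nat (can2_eq iK iK).
Qed.

Lemma conv_prob x y : prob_measure (conv (dirac R x) (dirac R y)).
Proof.
split=> [z|]; first by rewrite conv_dirac.
by under eq_bigr do rewrite conv_dirac.
Qed.

Lemma supp_unit x y : y = i x <-> e \in supp (conv (dirac R x) (dirac R y)).
Proof. by rewrite inE conv_dirac. Qed.

Definition hypergroup_of_constants : hypergroup R K :=
  Hypergroup conv_linearl conv_linearr conv_assoc conv1l conv1r
    star_antilinear starK star_conv conv_prob iK star_dirac supp_unit.

End StructureConstants.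

(** * The multiplication table and its verification in natural numbers *)

(* Row [x], column [y]: the coefficients of [48 c_x c_y] on [c_0, ..., c_4]. *)
Definition table : seq (seq (seq nat)) :=
  [:: [:: [:: 48; 0; 0; 0; 0]; [:: 0; 48; 0; 0; 0]; [:: 0; 0; 48; 0; 0];
          [:: 0; 0; 0; 48; 0]; [:: 0; 0; 0; 0; 48]];
      [:: [:: 0; 48; 0; 0; 0]; [:: 8; 7; 11; 11; 11]; [:: 0; 11; 11; 23; 3];
          [:: 0; 11; 23; 1; 13]; [:: 0; 11; 3; 13; 21]];
      [:: [:: 0; 0; 48; 0; 0]; [:: 0; 11; 11; 3; 23]; [:: 8; 11; 7; 11; 11];
          [:: 0; 3; 11; 21; 13]; [:: 0; 23; 11; 13; 1]];
      [:: [:: 0; 0; 0; 48; 0]; [:: 0; 11; 3; 21; 13]; [:: 0; 23; 11; 1; 13];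
          [:: 0; 13; 13; 9; 13]; [:: 8; 1; 21; 9; 9]];
      [:: [:: 0; 0; 0; 0; 48]; [:: 0; 11; 23; 13; 1]; [:: 0; 3; 11; 13; 21];
          [:: 8; 21; 1; 9; 9]; [:: 0; 13; 13; 13; 9]]].

(** Indices are plain naturals so that the identities below can be evaluated; the [nth] defaults are
    never reached for indices below 5. *)
Definition entry (x y z : nat) : nat := nth 0 (nth [::] (nth [::] table x) y) z.

Definition swap34 (x : nat) : nat := nth 0 [:: 0; 1; 2; 4; 3] x.

Lemma all_iotaP n (P : pred nat) : all P (iota 0 n) -> forall x : 'I_n, P x.
Proof. by move=> /allP Pn x; apply: Pn; rewrite mem_iota ltn_ord. Qed.

(** Big operators are locked against reduction, whereas [sumn] over [iota] evaluates under
    [vm_compute]. *)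
Lemma sum_ord_sumn n (F : nat -> nat) :
  \sum_(i < n) F i = sumn [seq F i | i <- iota 0 n].
Proof. by rewrite sumnE big_map -(big_mkord xpredT F) /index_iota subn0. Qed.

Lemma swap34_ltn (x : 'I_5) : swap34 x < 5.
Proof. by case: x => [[|[|[|[|[|]]]]]]. Qed.

Definition inv5 (x : 'I_5) : 'I_5 := Ordinal (swap34_ltn x).

Lemma inv5K : involutive inv5.
Proof. by case=> [[|[|[|[|[|]]]]] ?] //; apply: val_inj. Qed.

Lemma entry_sum (x y : 'I_5) : \sum_(z < 5) entry x y z = 48.
Proof.
have : all (fun x => all (fun y =>
  sumn [seq entry x y z | z <- iota 0 5] == 48) (iota 0 5)) (iota 0 5).
  by vm_compute.
move=> /all_iotaP/(_ x)/all_iotaP/(_ y)/eqP.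
by rewrite (sum_ord_sumn _ (entry x y)).
Qed.

(** Both sides carry the same scaling 48^2, so associativity amounts to 625 identities between
    naturals, checked by computation. *)
Lemma entry_assoc (x y z t : 'I_5) :
  \sum_(s < 5) entry x y s * entry s z t =
  \sum_(s < 5) entry y z s * entry x s t.
Proof.
pose all5 := all^~ (iota 0 5).
have : all5 (fun x => all5 (fun y => all5 (fun z => all5 (fun t =>
  sumn [seq entry x y s * entry s z t | s <- iota 0 5] ==
  sumn [seq entry y z s * entry x s t | s <- iota 0 5])))).
  by vm_compute.
move=> /all_iotaP/(_ x)/all_iotaP/(_ y)/all_iotaP/(_ z)/all_iotaP/(_ t)/eqP.
rewrite (sum_ord_sumn _ (fun s => entry x y s * entry s z t)).
by rewrite (sum_ord_sumn _ (fun s => entry y z s * entry x s t)).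
Qed.

Lemma entry1l (y z : 'I_5) : entry 0 y z = (y == z) * 48.
Proof. by move: y z; do 2 case=> [[|[|[|[|[|]]]]] ?] //. Qed.

Lemma entry1r (x z : 'I_5) : entry x 0 z = (x == z) * 48.
Proof. by move: x z; do 2 case=> [[|[|[|[|[|]]]]] ?] //. Qed.

Lemma entry_inv (x y z : 'I_5) :
  entry (swap34 x) (swap34 y) (swap34 z) = entry y x z.
Proof. by move: x y z; do 3 case=> [[|[|[|[|[|]]]]] ?] //. Qed.

Lemma entry_unit (x y : 'I_5) : (y == inv5 x) = (entry x y 0 != 0).
Proof. by move: x y; do 2 case=> [[|[|[|[|[|]]]]] ?] //. Qed.

(** * Division by 48 and the resulting hypergroup *)

Section Constants.

Local Open Scope ring_scope.

Variable R : realType.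

Definition hcoef (x y z : 'I_5) : R[i] := (entry x y z)%:R / 48%:R.

Let unit48 : (48%:R : R[i]) != 0. Proof. by rewrite pnatr_eq0. Qed.

Lemma hcoef_ge0 x y z : 0 <= hcoef x y z.
Proof. by rewrite divr_ge0 ?ler0n. Qed.

Lemma hcoef_sum1 x y : \sum_z hcoef x y z = 1.
Proof. by rewrite -mulr_suml -natr_sum entry_sum divff. Qed.

Lemma hcoef_assoc x y z t :
  \sum_s hcoef x y s * hcoef s z t =
  \sum_s hcoef y z s * hcoef x s t.
Proof.
under eq_bigr do rewrite /hcoef mulrACA -natrM.
under [RHS]eq_bigr do rewrite /hcoef mulrACA -natrM.
by rewrite -!mulr_suml -!natr_sum entry_assoc.
Qed.

Lemma hcoef1l y z : hcoef ord0 y z = (y == z)%:R.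
Proof. by rewrite /hcoef entry1l natrM mulfK. Qed.

Lemma hcoef1r x z : hcoef x ord0 z = (x == z)%:R.
Proof. by rewrite /hcoef entry1r natrM mulfK. Qed.

Lemma hcoef_inv x y z : hcoef (inv5 x) (inv5 y) (inv5 z) = hcoef y x z.
Proof. by rewrite /hcoef entry_inv. Qed.

Lemma hcoef_unit x y : y = inv5 x <-> hcoef x y ord0 != 0.
Proof.
rewrite mulf_eq0 invr_eq0 (negPf unit48) orbF pnatr_eq0 -entry_unit.
by split=> /eqP.
Qed.

Definition hypergroup5 : hypergroup R 'I_5 :=
  hypergroup_of_constants hcoef_ge0 hcoef_sum1 hcoef_assoc
    hcoef1l hcoef1r inv5K hcoef_inv hcoef_unit.

End Constants.

Theorem theorem4p2 (R : realType) :
  exists (K : finType) (H : hypergroup R K) (c0 c1 c2 c3 c4 : K),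
    [/\ [set: K] = [set c0; c1; c2; c3; c4],
        horder H = 5,
        hunit H = c0
      & ~ commutative_hypergroup H] /\
    [/\ hinv H c0 = c0,
        hinv H c1 = c1,
        hinv H c2 = c2,
        hinv H c3 = c4
      & hinv H c4 = c3].
Proof.
pose c k (lt_k5 : k < 5) : 'I_5 := Ordinal lt_k5.
exists 'I_5, (hypergroup5 R).
exists ord0, (@c 1 isT), (@c 2 isT), (@c 3 isT), (@c 4 isT).
split; split; try by apply: val_inj.
- by apply/setP => x; rewrite !inE; move: x => [[|[|[|[|[|]]]]] ?].
- exact: card_ord.
(* The coefficient of c_3 is 23/48 in c_1 c_2 but 3/48 in c_2 c_1. *)
- move=> /(_ (dirac R (@c 1 isT)) (dirac R (@c 2 isT))) /ffunP /(_ (@c 3 isT)).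
  rewrite /= !conv_dirac => /(mulIf _); rewrite invr_eq0 pnatr_eq0 => /(_ isT).
  by move/eqP; rewrite eqr_nat.
Qed.
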